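(* Let $n\geq 0$ be an integer. (1) For every prime $p\equiv 5,7,11\pmod{12}$ and every odd integer $k$ with $1\leq k<p$, \[\sigma_e\mathrm{mex}\Big(2p^2n+kp+\tfrac{p^2-1}{12}\Big)\equiv 0\pmod 4.\] (2) For every prime $p\equiv 5,7,11\pmod{24}$ and every integer $k$ with $1\leq k<p$ such that $k\equiv 1\pmod 4$ if $p\equiv 11\pmod{24}$, and $k\equiv 3\pmod 4$ if $p\equiv 5,7\pmod{24}$, \[\sigma_e\mathrm{mex}\Big(4p^2n+kp+\tfrac{p^2-1}{12}\Big)\equiv 0\pmod 8.\] (3) For every prime $p\equiv 5,7,11\pmod{24}$ and every integer $k$ with $1\leq k<p$ such that $k\equiv 0\pmod 4$ if $p\equiv 5,11\pmod{24}$, and $k\equiv 2\pmod 4$ if $p\equiv 7\pmod{24}$, \[\sigma_o\mathrm{mex}\Big(4p^2n+kp+\tfrac{p^2-1}{12}\Big)\equiv 0\pmod 4.\]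
   Context: A partition of a nonnegative integer $n$ is a non-increasing sequence of positive integers (parts) summing to $n$; $\mathcal{P}(n)$ denotes the set of partitions of $n$. The minimal excludant $\mathrm{mex}(\pi)$ of a partition $\pi$ is the least positive integer that is not a part of $\pi$. Define $\sigma_o\mathrm{mex}(n):=\sum_{\pi\in\mathcal{P}(n),\ 2\nmid \mathrm{mex}(\pi)}\mathrm{mex}(\pi)$ and $\sigma_e\mathrm{mex}(n):=\sum_{\pi\in\mathcal{P}(n),\ 2\mid \mathrm{mex}(\pi)}\mathrm{mex}(\pi)$, the sums of the odd, respectively even, minimal excludants over all partitions of $n$. *)

(* Defs.v *)
From HB Require Import structures.
From mathcomp Require Import all_boot.

Set Implicit Arguments.
Unset Strict Implicit.
Unset Printing Implicit Defensive.

Definition is_partition (n : nat) (s : seq nat) : bool :=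
  [&& sorted geq s, all (leq 1) s & sumn s == n].

Record partition_of (n : nat) : Type := PartitionOf {
  parts :> seq nat;
  _ : is_partition n parts
}.

HB.instance Definition _ (n : nat) := [isSub for @parts n].
HB.instance Definition _ (n : nat) := [Countable of partition_of n by <:].

Lemma mem_leq_sumn (s : seq nat) (m : nat) : m \in s -> m <= sumn s.
Proof.
elim: s => //= a s IHs; rewrite inE => /orP[/eqP-> | /IHs le_m].
  exact: leq_addr.
exact: leq_trans le_m (leq_addl _ _).
Qed.

Lemma size_leq_sumn (s : seq nat) : all (leq 1) s -> size s <= sumn s.
Proof.
by elim: s => //= a s IHs /andP[a_gt0 /IHs]; rewrite -add1n; apply: leq_add.
Qed.

(* The parts of a partition of n are at most n, and there are at most n of
   them: partitions of n embed in a finite type. *)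
Definition bseq_of_partition (n : nat) (pi : partition_of n) :
    n.-bseq 'I_n.+1 :=
  insub_bseq n [seq inord m | m <- parts pi].

Definition partition_of_bseq (n : nat) (t : n.-bseq 'I_n.+1) :
    option (partition_of n) :=
  insub [seq val i | i <- t].

Lemma bseq_of_partitionK (n : nat) :
  pcancel (@bseq_of_partition n) (@partition_of_bseq n).
Proof.
move=> pi; have /and3P[_ pos_pi /eqP sum_pi] := valP pi.
have le_n m : m \in parts pi -> m <= n.
  by move=> /mem_leq_sumn; rewrite sum_pi.
have sz : size [seq (inord m : 'I_n.+1) | m <- parts pi] <= n.
  by rewrite size_map -[X in _ <= X]sum_pi size_leq_sumn.
rewrite /partition_of_bseq /bseq_of_partition /insub_bseq.
have /= -> := insubdK ([bseq] : n.-bseq 'I_n.+1) sz; rewrite -map_comp.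
rewrite map_id_in ?valK // => m /le_n le_mn /=.
by rewrite inordK.
Qed.

HB.instance Definition _ (n : nat) :=
  isFinite.Build (partition_of n) (pcan_enumP (@bseq_of_partitionK n)).

Lemma mex_exists (s : seq nat) : exists m, (0 < m) && (m \notin s).
Proof.
by exists (sumn s).+1; apply/negP => /mem_leq_sumn; rewrite ltnn.
Qed.

Definition mex (s : seq nat) : nat := ex_minn (mex_exists s).

Definition sigma_o_mex (n : nat) : nat :=
  \sum_(pi : partition_of n | ~~ (2 %| mex pi)) mex pi.

Definition sigma_e_mex (n : nat) : nat :=
  \sum_(pi : partition_of n | 2 %| mex pi) mex pi.

(* Main.v *)
Require Import Defs.
From mathcomp Require Import all_boot all_order all_algebra.
From mathcomp Require Import finfield zify ring.

(** Write f1 = prod (1 - q^i), f2 = f1(q^2), S = sum_(n >= 1) (-1)^n q^(n^2) and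
    phi = 1 + 2 S.  Counting the partitions that contain 1, ..., m expresses
      twice
    the generating functions E, O of the even and odd mex sums as
    (psi -+ f1^3) / f1, where psi = sum_(m >= 0) q^(m(m+1)/2).  With the theta
    identities f1^2 = f2 phi and f1 psi = f2^2 this becomes
    phi E = - 2 f2 (S + S^2) and O = E + f1^2.

    Let p divide 12 N + 1 exactly once.  The coefficient of q^N in f1^2
      vanishes:
    expanding f1 * f1 it counts solutions of 2 (12 N + 1) = x^2 + y^2 (excluded
    if p = 3 mod 4), and expanding f2 * phi solutions of 12 N + 1 = x^2 + 12 y^2
    (excluded if p = 2 mod 3).  Likewise for f2, hence for f2 S, and the
    congruences follow by expanding 1 / phi modulo 2 and 4, using S^2 = S(q^2)
    and f1 (S + S(q^2)) = q f1' modulo 2.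

    Power series are represented by integer polynomials, compared below degree
      K. *)

Set Implicit Arguments.
Unset Strict Implicit.
Unset Printing Implicit Defensive.

Import GRing.Theory.

(** * Congruences between truncated power series *)

Section TruncatedIdeal.
Local Open Scope ring_scope.

(** Membership in the ideal generated by [m] and ['X^K]. As 0 divides only 0, the case [m = 0]
    expresses exact identities of power series up to order [K]. *)
Definition tideal (m : int) (K : nat) (p : {poly int}) : Prop :=
  forall i, (i < K)%N -> (m %| p`_i)%Z.

Lemma tideal0 m K : tideal m K 0.
Proof. by move=> i _; rewrite coef0 dvdz0. Qed.

Lemma tidealD m K p q : tideal m K p -> tideal m K q -> tideal m K (p + q).
Proof. by move=> hp hq i hi; rewrite coefD rpredD ?hp ?hq. Qed.

Lemma tidealN m K p : tideal m K p -> tideal m K (- p).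
Proof. by move=> hp i hi; rewrite coefN rpredN hp. Qed.

Lemma tidealMl m K q p : tideal m K p -> tideal m K (q * p).
Proof.
move=> hp i hi; rewrite coefM rpred_sum // => j _; apply/dvdz_mull/hp.
exact: leq_ltn_trans (leq_subr _ _) hi.
Qed.

Lemma tidealMr m K q p : tideal m K p -> tideal m K (p * q).
Proof. by rewrite mulrC; apply: tidealMl. Qed.

Lemma tideal_sum m K I (r : seq I) (P : pred I) (F : I -> {poly int}) :
  (forall i, P i -> tideal m K (F i)) -> tideal m K (\sum_(i <- r | P i) F i).
Proof.
move=> hF; apply: (big_ind (tideal m K)) => //; first exact: tideal0.
exact: tidealD.
Qed.

Lemma tidealXn m K e p : (K <= e)%N -> tideal m K ('X^e * p).
Proof. by move=> le i hi; rewrite coefXnM (leq_trans hi le) dvdz0. Qed.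

Lemma tideal_leq m K L p : (K <= L)%N -> tideal m L p -> tideal m K p.
Proof. by move=> le hp i hi; apply/hp/(leq_trans hi). Qed.

Lemma tideal_dvd m m' K p : (m' %| m)%Z -> tideal m K p -> tideal m' K p.
Proof. by move=> dm hp i hi; apply: dvdz_trans dm (hp i hi). Qed.

(** A series with constant term 1 is invertible: coefficient [i] of [u * p] is that of [p] plus
    multiples of earlier coefficients of [p]. *)
Lemma tideal_cancel m K (u p : {poly int}) :
  u`_0 = 1 -> tideal m K (u * p) -> tideal m K p.
Proof.
move=> u0 hup i; elim/ltn_ind: i => i IH hi.
have := hup i hi; rewrite coefM big_ord_recl /= u0 mul1r subn0.
rewrite rpredDr // rpred_sum // => j _; apply/dvdz_mull/IH; rewrite /bump /=.
  by rewrite add1n; have := ltn_ord j; lia.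
by rewrite add1n; have := ltn_ord j; lia.
Qed.

Lemma tideal_nat m K (c : nat) p :
  (0 < c)%N -> tideal (m * c%:Z) K (p *+ c) -> tideal m K p.
Proof.
move=> c0 hp i /hp; rewrite coefMn -mulr_natr natz dvdz_mul2r //; lia.
Qed.

Lemma tidealMn m K (c : nat) p : tideal m K p -> tideal (m * c%:Z) K (p *+ c).
Proof. by move=> hp i /hp; rewrite coefMn -mulr_natr natz => h;
  apply: dvdz_mul. Qed.

Lemma tideal_coef0 K (p q : {poly int}) i : tideal 0 K (p - q) -> (i < K)%N ->
  p`_i = q`_i.
Proof. by move=> h /h; rewrite coefB dvd0z subr_eq0 => /eqP. Qed.

Lemma tideal_eq m K p q : tideal m K q -> p = q -> tideal m K p.
Proof. by move=> h ->. Qed.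

End TruncatedIdeal.

(** * Gaussian binomials and a finite triple product *)

Section GaussianBinomial.
Local Open Scope ring_scope.
Variables (R : comNzRingType) (q : R).

(** Defined by the q-Pascal rule, since quotients of q-factorials need not make sense in [R]. *)
Fixpoint gbin (m k : nat) : R :=
  match m, k with
  | _, 0 => 1
  | 0, _.+1 => 0
  | m'.+1, k'.+1 => gbin m' k' + q ^+ k'.+1 * gbin m' k'.+1
  end.

Arguments gbin : simpl never.

Definition qpoch (n : nat) : R := \prod_(i < n) (1 - q ^+ i.+1).

Lemma gbin0 m : gbin m 0 = 1. Proof. by case: m. Qed.

Lemma gbinS m k : gbin m.+1 k.+1 = gbin m k + q ^+ k.+1 * gbin m k.+1.
Proof. by []. Qed.

Lemma gbin_small m k : (m < k)%N -> gbin m k = 0.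
Proof.
elim: m k => [|m IH] [|k] //; rewrite ltnS => lt.
by rewrite gbinS !IH ?mulr0 ?addr0 // ltnW.
Qed.

Lemma gbinS' m k : gbin m.+1 k.+1 = q ^+ (m - k) * gbin m k + gbin m k.+1.
Proof.
elim: m k => [|m IH] k.
  by rewrite sub0n expr0 gbinS mul1r (gbin_small (ltn0Sn k)) mulr0.
rewrite gbinS; case: k => [|k].
  by rewrite {1}IH (gbinS m 0) !gbin0 !subn0 !exprS; ring.
rewrite {1}IH {1}[gbin m.+1 k.+2]IH !gbinS subSS.
have [lt|le] := ltnP k m; last by rewrite (gbin_small (m := m) (k := k.+1)) //;
  ring.
rewrite -(subnSK lt) !exprS; ring.
Qed.

(** The quotient formula cleared of denominators. The induction splits 1 - q^(a+b+2) as (1 -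
    q^(a+1)) + q^(a+1) (1 - q^(b+1)). *)
Lemma gbin_qpoch a b : gbin (a + b) a * qpoch a * qpoch b = qpoch (a + b).
Proof.
elim: a b => [|a IHa] b; first by rewrite gbin0 {1}/qpoch big_ord0 !mul1r.
elim: b => [|b IHb].
  have gnn c : gbin c c = 1.
    by elim: c => // c IH; rewrite gbinS IH gbin_small // mulr0 addr0.
  by rewrite addn0 gnn {2}/qpoch big_ord0 mul1r mulr1.
have qS c : qpoch c.+1 = qpoch c * (1 - q ^+ c.+1)
  by rewrite /qpoch big_ord_recr.
have -> : (a.+1 + b.+1 = (a + b).+2)%N by lia.
rewrite gbinS; have := IHa b.+1; have := IHb.
rewrite addSn addnS !qS => h1 h2.
have -> : q ^+ (a + b).+2 = q ^+ a.+1 * q ^+ b.+1 by rewrite -exprD;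
  congr (_ ^+ _); lia.
rewrite mulrDl mulrDl.
have -> : gbin (a + b).+1 a * (qpoch a * (1 - q ^+ a.+1)) * (qpoch b * (1 -
  q ^+ b.+1))
  = (1 - q ^+ a.+1) * (gbin (a + b).+1 a * qpoch a * (qpoch b * (1 -
    q ^+ b.+1))) by ring.
have -> : q ^+ a.+1 * gbin (a + b).+1 a.+1 * (qpoch a * (1 -
  q ^+ a.+1)) * (qpoch b * (1 - q ^+ b.+1))
  = (1 - q ^+ b.+1) * q ^+ a.+1 * (gbin (a +
    b).+1 a.+1 * (qpoch a * (1 - q ^+ a.+1)) * qpoch b) by ring.
by rewrite h1 h2; ring.
Qed.

(** The q-Pascal rule transferred to the weights, so that a row of Gaussian binomials can be
    lowered; [gbin_sumS'] does the same with the other rule. *)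
Lemma gbin_sumS m (V : nat -> R) :
  \sum_(k < m.+2) gbin m.+1 k * V k =
  \sum_(k < m.+1) gbin m k * (q ^+ k * V k + V k.+1).
Proof.
rewrite -(big_mkord xpredT (fun k => gbin m.+1 k * V k)).
rewrite -(big_mkord xpredT (fun k => gbin m k * (q ^+ k * V k + V k.+1))).
rewrite big_nat_recl // gbin0.
under eq_bigr do rewrite gbinS mulrDl.
under [RHS]eq_bigr do rewrite mulrDr.
rewrite !big_split /= [X in _ + (_ + X)]big_nat_recr //= gbin_small //.
rewrite [X in _ = X + _]big_nat_recl // gbin0 expr0 mulr0 mul0r addr0 !mul1r.
rewrite [X in _ + X = _]addrC addrA; congr (_ + _ + _).
by apply: eq_bigr => i _; ring.
Qed.

Lemma gbin_sumS' m (V : nat -> R) :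
  \sum_(k < m.+2) gbin m.+1 k * V k =
  \sum_(k < m.+1) gbin m k * (V k + q ^+ (m - k) * V k.+1).
Proof.
rewrite -(big_mkord xpredT (fun k => gbin m.+1 k * V k)).
rewrite -(big_mkord xpredT (fun k => gbin m k * (V k + q ^+ (m - k) * V k.+1))).
rewrite big_nat_recl // gbin0.
under eq_bigr do rewrite gbinS' mulrDl.
under [RHS]eq_bigr do rewrite mulrDr.
rewrite !big_split /= [X in _ + (_ + X)]big_nat_recr //= gbin_small //.
rewrite [X in _ = X + _]big_nat_recl // gbin0 mul0r addr0 !mul1r.
rewrite [X in _ + X = _]addrC addrA; congr (_ + _ + _).
by apply: eq_bigr => i _; ring.
Qed.

(* Over Laurent polynomials in z, the weight W(j) = q^(j(j-1)/2) z^j solves the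
   recurrence, and this is the finite form of the Jacobi triple product. *)
Lemma finite_triple_product (e : nat) (W : int -> R) (lam : nat -> R) :
  (forall n k : nat, (k <= n.*2 + e)%N ->
     q ^+ k * W (k%:Z - n%:Z - 1) + q ^+ (n.*2 + e - k) * W (k%:Z - n%:Z + 1)
     = lam n * W (k%:Z - n%:Z)) ->
  forall n, \sum_(k < (n.*2 + e).+1) gbin (n.*2 + e) k * W (k%:Z - n%:Z)
    = (\prod_(i < n) (1 + q ^+ (i.*2 + e).+1 + lam i))
      * \sum_(k < e.+1) gbin e k * W k%:Z.
Proof.
move=> hW; elim=> [|n IH].
  by rewrite big_ord0 mul1r add0n; apply: eq_bigr => k _; rewrite subr0.
rewrite [in RHS]big_ord_recr /= mulrAC -IH doubleS !addSn.
(* Using each Pascal rule once lowers the row by two. The middle weight [W (k - n)] then carries 1 +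
   q^(2n+e+1), and the two outer weights combine to [lam n] by hypothesis. *)
rewrite (gbin_sumS _ (fun k => W (k%:Z - n.+1%:Z))).
rewrite (gbin_sumS' _ (fun k => q ^+ k * W (k%:Z - n.+1%:Z) +
  W (k.+1%:Z - n.+1%:Z))).
rewrite mulr_suml; apply: eq_bigr => k _; rewrite -mulrA; congr (_ * _).
have lek : (k <= n.*2 + e)%N by rewrite -ltnS ltn_ord.
rewrite [RHS]mulrC !mulrDl mul1r -(hW n k lek).
have -> : k%:Z - n.+1%:Z = k%:Z - n%:Z - 1 by lia.
have -> : k.+1%:Z - n.+1%:Z = k%:Z - n%:Z by lia.
have -> : k.+2%:Z - n.+1%:Z = k%:Z - n%:Z + 1 by lia.
have -> : q ^+ (n.*2 + e).+1 = q ^+ k.+1 * q ^+ (n.*2 + e - k)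
  by rewrite -exprD; congr (_ ^+ _); lia.
ring.
Qed.

End GaussianBinomial.

(** * Theta identities as limits of the finite triple product *)

Section Theta.
Local Open Scope ring_scope.

Implicit Types (p : {poly int}).

Lemma tideal0_dvd D p : tideal 0 D p -> exists r, p = 'X^D * r.
Proof.
move=> hp; exists (drop_poly D p); rewrite -[LHS](poly_take_drop D) mulrC.
suff -> : take_poly D p = 0 by rewrite add0r.
apply/polyP => i; rewrite coef_take_poly coef0; case: ifP => // lt.
by apply/eqP; rewrite -dvd0z hp.
Qed.

Lemma qpoch_coef0 d M : (0 < d)%N -> (qpoch ('X^d : {poly int}) M)`_0 = 1.
Proof.
move=> d0; rewrite -horner_coef0 /qpoch horner_prod big1 // => i _.
by rewrite !hornerE expr0n gtn_eqF // expr0n subr0.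
Qed.

Lemma qpoch_trunc m d a M : (a <= M)%N ->
  tideal m (d * a.+1) (qpoch ('X^d) M - qpoch 'X^d a).
Proof.
elim: M => [|M IH]; first by rewrite leqn0 => /eqP ->; rewrite subrr;
  apply: tideal0.
rewrite leq_eqVlt => /orP[/eqP ->|]; first by rewrite subrr; apply: tideal0.
rewrite ltnS => le.
apply: (@tideal_eq _ _ _ ((qpoch ('X^d) M - qpoch 'X^d a) +
  - ('X^(d * M.+1) * qpoch 'X^d M))).
  apply: tidealD; first exact: IH.
  by apply/tidealN/tidealXn; rewrite leq_mul2l ltnS le orbT.
by rewrite {1}/qpoch big_ord_recr /= -/(qpoch _ _) -exprM; ring.
Qed.

(** To this order all the products [qpoch] involved agree with the one of length [minn a b], so the
    quotient formula leaves the inverse of a single product. *)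
Lemma gbin_trunc d a b M : (0 < d)%N -> (minn a b <= M)%N ->
  tideal 0 (d * (minn a b).+1) (gbin ('X^d) (a + b) a * qpoch 'X^d M - 1).
Proof.
move=> d0 leM; set c := minn a b; set D := (d * _)%N.
have tr x : (c <= x)%N -> tideal 0 D (qpoch ('X^d) x - qpoch 'X^d c).
  exact: qpoch_trunc.
apply: (@tideal_cancel _ _ (qpoch 'X^d c)); first exact: qpoch_coef0.
have hab := gbin_qpoch ('X^d : {poly int}) a b.
have ha := tr a (geq_minl _ _); have hb := tr b (geq_minr _ _).
have hM := tr M leM; have hs := tr (a + b)%N (leq_trans (geq_minl _ _)
  (leq_addr _ _)).
move: hab ha hb hM hs; move: (gbin _ _ _) (qpoch _ a) (qpoch _ b) (qpoch _ M).
move: (qpoch _ c) (qpoch _ (a + b)) => t s g qa qb qM <- ha hb hM hs.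
apply: (@tideal_eq _ _ _ (g * t * (qM - t) + - (g * t * (qb - t)) +
  - (g * qb * (qa - t)) + (g * qa * qb - t))).
  apply: tidealD => //; apply: tidealD; last exact/tidealN/tidealMl.
  by apply: tidealD; last apply: tidealN; apply: tidealMl.
by ring.
Qed.

(** The passage to the limit. Replacing a binomial by the inverse product is a poor approximation
    near both ends of the row; the last hypothesis asks that [V k] have high order there. *)
Lemma theta_trunc d K m M (V : nat -> {poly int}) : (0 < d)%N ->
  (forall k, (k <= m)%N -> (minn k (m - k) <= M)%N) ->
  (forall k, (k <= m)%N -> tideal 0 K ('X^(d * (minn k (m - k)).+1) * V k)) ->
  tideal 0 K (qpoch 'X^d M * (\sum_(k < m.+1) gbin 'X^d m k * V k)
              - \sum_(k < m.+1) V k).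
Proof.
move=> d0 hM hV; rewrite mulr_sumr -sumrB; apply: tideal_sum => k _.
have lek : (k <= m)%N by rewrite -ltnS.
have := gbin_trunc d0 (hM k lek); rewrite subnKC // => /tideal0_dvd[r hr].
apply: (@tideal_eq _ _ _ (r * ('X^(d * (minn k (m - k)).+1) * V k))).
  exact/tidealMl/hV.
have -> : qpoch 'X^d M * (gbin 'X^d m k * V k) - V k =
  (gbin 'X^d m k * qpoch 'X^d M - 1) * V k by ring.
by rewrite hr; ring.
Qed.

(** Exponents of two-sided theta series. The absolute values only convert to [nat], as all three
    quantities are nonnegative, and both halvings are exact. *)
Definition tri (j : int) : nat := (`|(j * (j - 1))%R| %/ 2)%N.
Definition pent (j : int) : nat := (`|(j * (3 * j - 1))%R| %/ 2)%N.
Definition sq (j : int) : nat := `|(j * j)%R|%N.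

Lemma triE j : (tri j)%:Z * 2 = j * (j - 1).
Proof.
have [i ij] : exists i, j = 2 * i \/ j = 2 * i + 1 by exists (j %/ 2)%Z; lia.
by rewrite /tri; case: ij => ->; nia.
Qed.

Lemma pentE j : (pent j)%:Z * 2 = j * (3 * j - 1).
Proof.
have [i ij] : exists i, j = 2 * i \/ j = 2 * i + 1 by exists (j %/ 2)%Z; lia.
rewrite /pent; case: ij => ->.
  have : 0 <= i * (6 * i - 1) by nia.
  lia.
have : 0 <= (2 * i + 1) * (3 * i + 1).
  have [] : 0 <= i \/ i <= -1 by lia.
    nia.
  nia.
lia.
Qed.

Lemma sqE j : (sq j)%:Z = j * j.
Proof. by rewrite /sq; nia. Qed.

Definition sgi (j : int) : {poly int} := (-1) ^+ `|j|%N.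

Lemma sgiS j : sgi (j + 1) = - sgi j.
Proof.
rewrite /sgi -[RHS]mulN1r -exprS -signr_odd -[RHS]signr_odd; congr ((-1) ^+ _).
by congr nat_of_bool; lia.
Qed.

Lemma sgiP j : sgi (j - 1) = - sgi j.
Proof. by rewrite -{2}(subrK 1 j) sgiS opprK. Qed.

Lemma sum_sym0 (W : int -> {poly int}) n :
  \sum_(k < n.*2.+1) W (k%:Z - n%:Z) = W 0 + \sum_(j < n) (W j.+1%:Z +
    W (- j.+1%:Z)).
Proof.
elim: n => [|n IH].
  by rewrite double0 big_ord1 big_ord0 [RHS]addr0; congr W; lia.
rewrite doubleS big_ord_recl big_ord_recr /= [in RHS]big_ord_recr /= [RHS]addrA
  -IH.
rewrite [LHS]addrCA [in LHS](addrC (W _)); congr (_ + (_ + _)).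
- by apply: eq_bigr => k _; congr W; rewrite /bump /= add1n; lia.
- by congr W; rewrite /bump add1n; lia.
- by congr W; lia.
Qed.

(** The pairing follows the reflection j -> 1 - j, which preserves [tri]. *)
Lemma sum_sym1 (W : int -> {poly int}) n :
  \sum_(k < n.*2.+2) W (k%:Z - n%:Z) = \sum_(j < n.+1) (W j.+1%:Z + W (- j%:Z)).
Proof.
elim: n => [|n IH]; first by rewrite !big_ord_recr !big_ord0 /= !add0r oppr0
  addrC.
rewrite doubleS big_ord_recl big_ord_recr /= [in RHS]big_ord_recr /= -IH.
rewrite [LHS]addrCA [in LHS](addrC (W _)); congr (_ + (_ + _)).
- by apply: eq_bigr => k _; congr W; rewrite /bump /= add1n; lia.
- by congr W; rewrite /bump add1n; lia.
- by congr W; lia.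
Qed.

Definition Sseries (K : nat) : {poly int} :=
  \sum_(j < K) (-1) ^+ j.+1 * 'X^(j.+1 ^ 2).

Definition psiseries (K : nat) : {poly int} := \sum_(j < K.+1) 'X^('C(j.+1, 2)).

(** Jacobi's series for the cube of f1. *)
Definition Jseries (K : nat) : {poly int} :=
  \sum_(j < K.+1) (-1) ^+ j * (j.*2.+1)%:R * 'X^('C(j.+1, 2)).

Definition pentseries (K : nat) : {poly int} :=
  \sum_(k < K.*2.+1) sgi (k%:Z - K%:Z) * 'X^(pent (k%:Z - K%:Z)).

Lemma qpochS (q : {poly int}) n : qpoch q n.+1 = qpoch q n * (1 - q ^+ n.+1).
Proof. by rewrite /qpoch big_ord_recr. Qed.

Lemma qpoch_trunc1 m K M : (K <= M)%N -> tideal m K (qpoch 'X M - qpoch 'X K).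
Proof.
move=> le; have := @qpoch_trunc m 1 K M le; rewrite expr1 mul1n.
exact: tideal_leq.
Qed.

(** Triple product with base q^2 and weights (-1)^j q^(j^2): the factors are (1 - q^(2i+1))^2, and
    f2 times the product of the 1 - q^(2i+1) is f1. *)
Lemma theta_phi K :
  tideal 0 K (qpoch 'X K ^+ 2 - qpoch 'X^2 K * (1 + Sseries K *+ 2)).
Proof.
pose W (j : int) : {poly int} := sgi j * 'X^(sq j).
have hW n k : (k <= n.*2 + 0)%N ->
    ('X^2) ^+ k * W (k%:Z - n%:Z - 1) + 'X^2 ^+ (n.*2 +
      0 - k) * W (k%:Z - n%:Z + 1)
     = (- ('X^(n.*2.+1) *+ 2)) * W (k%:Z - n%:Z).
  move=> le; rewrite /W sgiS sgiP -!exprM; move: (sgi _) => s.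
  have e1 : 'X^(2 * k) * 'X^(sq (k%:Z - n%:Z - 1)) =
    'X^(n.*2.+1) * 'X^(sq (k%:Z - n%:Z)) :> {poly int}.
    by rewrite -!exprD; congr ('X^_); have := sqE (k%:Z - n%:Z - 1);
      have := sqE (k%:Z - n%:Z); lia.
  have e2 : 'X^(2 * (n.*2 + 0 - k)) * 'X^(sq (k%:Z - n%:Z + 1)) =
    'X^(n.*2.+1) * 'X^(sq (k%:Z - n%:Z)) :> {poly int}.
    by rewrite -!exprD; congr ('X^_); have := sqE (k%:Z - n%:Z + 1);
      have := sqE (k%:Z - n%:Z); lia.
  have -> : 'X^(2 * k) * (- s * 'X^(sq (k%:Z - n%:Z - 1))) =
    - s * ('X^(2 * k) * 'X^(sq (k%:Z - n%:Z - 1))) by ring.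
  have -> : 'X^(2 * (n.*2 + 0 - k)) * (- s * 'X^(sq (k%:Z - n%:Z + 1))) =
    - s * ('X^(2 * (n.*2 + 0 - k)) * 'X^(sq (k%:Z - n%:Z + 1))) by ring.
  by rewrite e1 e2; ring.
have ft := finite_triple_product hW K.
have tt : tideal 0 K (qpoch 'X^2 K * (\sum_(k < K.*2.+1) gbin 'X^2 K.*2 k * W
  (k%:Z - K%:Z))
              - \sum_(k < K.*2.+1) W (k%:Z - K%:Z)).
  apply: (@theta_trunc 2 K K.*2 K (fun k => W (k%:Z - K%:Z))) => // k le;
    first by lia.
  rewrite /W mulrCA -exprD; apply/tidealMl; rewrite -['X^_]mulr1;
    apply: tidealXn.
  (* With j = k - K, nonnegativity of (j - 1)^2 and (j + 1)^2 gives 2|j| <= j^2 + 1, which makes the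
     exponent at least [K]. *)
  have := sqE (k%:Z - K%:Z); have := sqE (k%:Z - K%:Z - 1).
  have := sqE (k%:Z - K%:Z + 1).
  by lia.
rewrite addn0 in ft; rewrite {}ft sum_sym0 big_ord1 gbin0 mul1r in tt.
have W0 : W 0 = 1 by rewrite /W /sgi /sq mul0r !expr0 mul1r.
pose o : {poly int} := \prod_(i < K) (1 - 'X^(i.*2.+1)).
have ho : qpoch 'X^2 K * o = qpoch 'X K.*2.
  rewrite /o; elim: (K) => [|n IH]; first by rewrite /qpoch !big_ord0 mulr1.
  rewrite doubleS !qpochS -IH big_ord_recr /= -!exprM.
  have -> : (2 * n.+1)%N = n.*2.+2 by lia.
  by ring.
have hp : \prod_(i < K) (1 + 'X^2 ^+ (i.*2 + 0).+1 + - ('X^(i.*2.+1) *+ 2)) =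
  o ^+ 2.
  rewrite /o -prodrXl; apply: eq_bigr => i _; rewrite addn0 -exprM mulnC exprM;
    ring.
have hS : \sum_(j < K) (W j.+1%:Z + W (- j.+1%:Z)) = Sseries K *+ 2.
  rewrite -sumrMnl; apply: eq_bigr => j _;
    rewrite /W /sgi /sq mulrNN abszN -mulr2n.
  by congr (_ * 'X^_ *+ 2); lia.
rewrite {}hp W0 hS mulr1 in tt; have h2 := @qpoch_trunc1 0 K K.*2.
rewrite -ho in h2; move: tt h2; rewrite -addnn leq_addr => tt /(_ isT) h2.
apply: (@tideal_eq _ _ _ (qpoch 'X^2 K * (qpoch 'X^2 K * o ^+ 2 - (1 +
  Sseries K *+ 2))
   + - ((qpoch 'X^2 K * o + qpoch 'X K) * (qpoch 'X^2 K * o - qpoch 'X K)))).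
  by apply: tidealD; last apply: tidealN; apply: tidealMl.
by ring.
Qed.

Lemma gbin11 : gbin ('X : {poly int}) 1 1 = 1.
Proof. by rewrite gbinS gbin0 gbin_small // mulr0 addr0. Qed.

Lemma tri0 : tri 0 = 0%N. Proof. by []. Qed.

Lemma tri1 : tri 1 = 0%N. Proof. by []. Qed.

Lemma tri_nat j : tri j.+1%:Z = 'C(j.+1, 2).
Proof. by rewrite /tri bin2 -divn2; congr (_ %/ 2)%N; lia. Qed.

Lemma tri_opp j : tri (- j%:Z) = 'C(j.+1, 2).
Proof. by rewrite -tri_nat; have := triE j.+1%:Z; have := triE (- j%:Z); lia.
  Qed.

Lemma tri_steps (n k : nat) : (k <= n.*2 + 1)%N ->
   'X ^+ k * 'X^(tri (k%:Z - n%:Z - 1)) = 'X^(n.+1) * 'X^(tri (k%:Z -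
     n%:Z)) :> {poly int} /\
   'X ^+ (n.*2 + 1 - k) * 'X^(tri (k%:Z - n%:Z + 1)) =
     'X^(n.+1) * 'X^(tri (k%:Z - n%:Z)) :> {poly int}.
Proof.
move=> le; split; rewrite -!exprD; congr ('X^_); have := triE (k%:Z - n%:Z);
  [have := triE (k%:Z - n%:Z - 1) | have := triE (k%:Z - n%:Z + 1)]; lia.
Qed.

Lemma tri_trunc K k (p : {poly int}) : (k <= K.*2 + 1)%N ->
  tideal 0 K ('X^(1 * (minn k (K.*2 + 1 - k)).+1) * (p * 'X^(tri (k%:Z -
    K%:Z)))).
Proof.
move=> le; rewrite mulrCA -exprD; apply/tidealMl; rewrite -['X^_]mulr1;
  apply: tidealXn.
have := triE (k%:Z - K%:Z); have := triE (k%:Z - K%:Z - 1).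
have := triE (k%:Z - K%:Z + 1).
by lia.
Qed.

(** Triple product with base q and weights q^(j(j-1)/2): the factors are (1 + q^(i+1))^2, and f1
    times the product of the 1 + q^(i+1) is f2. The reflection j -> 1 - j doubles both sides, whence
    the final halving. *)
Lemma theta_psi K :
  tideal 0 K (qpoch 'X K * psiseries K - qpoch 'X^2 K ^+ 2).
Proof.
pose W (j : int) : {poly int} := 1 * 'X^(tri j).
have hW n k : (k <= n.*2 + 1)%N ->
    'X ^+ k * W (k%:Z - n%:Z - 1) + 'X ^+ (n.*2 + 1 - k) * W (k%:Z - n%:Z + 1)
     = ('X^(n.+1) *+ 2) * W (k%:Z - n%:Z).
  by move=> /tri_steps[e1 e2]; rewrite /W !mul1r e1 e2; ring.
have ft := finite_triple_product hW K.
have tt : tideal 0 K (qpoch 'X K * (\sum_(k < (K.*2 + 1).+1) gbin 'X (K.*2 +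
  1) k * W (k%:Z - K%:Z))
              - \sum_(k < (K.*2 + 1).+1) W (k%:Z - K%:Z)).
  have := @theta_trunc 1 K (K.*2 + 1) K (fun k => W (k%:Z - K%:Z));
    rewrite expr1.
  by apply=> // k le; [lia | apply: tri_trunc].
rewrite {}ft in tt; rewrite addn1 sum_sym1 big_ord_recr big_ord1 /= in tt.
have hW0 : gbin 'X 1 0 * W 0 + gbin 'X 1 1 * W 1 = 1 *+ 2.
  by rewrite gbin0 gbin11 !mul1r /W tri0 expr0 mul1r.
pose o : {poly int} := \prod_(i < K) (1 + 'X^(i.+1)).
have ho : qpoch 'X K * o = qpoch 'X^2 K.
  rewrite /o; elim: (K) => [|n IH]; first by rewrite /qpoch !big_ord0 mulr1.
  by rewrite !qpochS -IH big_ord_recr /= -!exprM [(2 * _)%N]mulnC exprM; ring.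
have hp : \prod_(i < K) (1 + 'X ^+ (i.*2 + 1).+1 + 'X^(i.+1) *+ 2) = o ^+ 2.
  rewrite /o -prodrXl; apply: eq_bigr => i _.
  by rewrite (_ : (i.*2 + 1).+1 = (i.+1 * 2)%N) ?exprM; [ring | lia].
have hS : \sum_(j < K.+1) (W j.+1%:Z + W (- j%:Z)) = psiseries K *+ 2.
  by rewrite -sumrMnl; apply: eq_bigr => j _; rewrite /W tri_nat tri_opp mul1r.
rewrite {}hp hW0 hS in tt.
have {tt} : tideal 0 K (qpoch 'X K * o ^+ 2 - psiseries K).
  apply: (@tideal_nat _ _ 2) => //; rewrite mul0r; apply: tideal_eq tt _; ring.
move=> /(tidealMl (- qpoch 'X K)) h; apply: tideal_eq h _; rewrite -ho; ring.
Qed.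

(** The purely alternating weights cancel under j -> 1 - j. The extra factor 2j - 1, a trace of
    differentiating in z, is odd under this reflection and keeps the recurrence valid because (2j -
    3) + (2j + 1) = 2 (2j - 1). *)
Lemma theta_J K :
  tideal 0 K (Jseries K - qpoch 'X K ^+ 3).
Proof.
pose W (j : int) : {poly int} := sgi j * (2 * j - 1)%:~R * 'X^(tri j).
have hW n k : (k <= n.*2 + 1)%N ->
    'X ^+ k * W (k%:Z - n%:Z - 1) + 'X ^+ (n.*2 + 1 - k) * W (k%:Z - n%:Z + 1)
     = (- ('X^(n.+1) *+ 2)) * W (k%:Z - n%:Z).
  move=> /tri_steps[e1 e2]; rewrite /W sgiS sgiP.
  move: e1 e2; move: (k%:Z - n%:Z) => j e1 e2;
    rewrite mulrCA e1 [X in _ + X = _]mulrCA e2.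
  by rewrite !(rmorphB, rmorphD, rmorphM) /=; ring.
have ft := finite_triple_product hW K.
have tt : tideal 0 K (qpoch 'X K * (\sum_(k < (K.*2 + 1).+1) gbin 'X (K.*2 +
  1) k * W (k%:Z - K%:Z))
              - \sum_(k < (K.*2 + 1).+1) W (k%:Z - K%:Z)).
  have := @theta_trunc 1 K (K.*2 + 1) K (fun k => W (k%:Z - K%:Z));
    rewrite expr1.
  by apply=> // k le; [lia | apply: tri_trunc].
rewrite {}ft in tt; rewrite addn1 sum_sym1 big_ord_recr big_ord1 /= in tt.
have hW0 : gbin 'X 1 0 * W 0 + gbin 'X 1 1 * W 1 = - (1 *+ 2).
  rewrite gbin0 gbin11 /W tri0 ?tri1 /sgi !mul1r !expr0 /=; ring.
have hp : \prod_(i < K) (1 + 'X ^+ (i.*2 + 1).+1 + - ('X^(i.+1) *+ 2)) =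
  qpoch ('X : {poly int}) K ^+ 2.
  rewrite /qpoch -prodrXl.
  apply: eq_bigr => i _.
  by rewrite (_ : (i.*2 + 1).+1 = (i.+1 * 2)%N) ?exprM; [ring | lia].
have hS : \sum_(j < K.+1) (W j.+1%:Z + W (- j%:Z)) = - (Jseries K *+ 2).
  rewrite -sumrMnl -sumrN; apply: eq_bigr => j _; rewrite /W tri_nat tri_opp.
  have -> : sgi (- j%:Z) = (-1) ^+ j by rewrite /sgi abszN.
  have -> : sgi j.+1 = - (-1) ^+ j by rewrite /sgi exprS mulN1r.
  have -> : 2 * j.+1%:Z - 1 = (j.*2.+1)%:Z by lia.
  have -> : 2 * (- j%:Z) - 1 = - (j.*2.+1)%:Z by lia.
  rewrite rmorphN /= -!pmulrn; ring.
rewrite {}hp hW0 hS in tt.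
apply: (@tideal_nat _ _ 2) => //; rewrite mul0r; apply: tideal_eq tt _; ring.
Qed.

(** Triple product with base q^3: the factors (1 - q^(3i+1)) (1 - q^(3i+2)) supply the exponents of
    f1 not divisible by 3. *)
Lemma pentagonal K : tideal 0 K (qpoch 'X K - pentseries K).
Proof.
pose W (j : int) : {poly int} := sgi j * 'X^(pent j).
have hW n k : (k <= n.*2 + 0)%N ->
    ('X^3) ^+ k * W (k%:Z - n%:Z - 1) + 'X^3 ^+ (n.*2 +
      0 - k) * W (k%:Z - n%:Z + 1)
     = (- ('X^((n * 3).+1) + 'X^((n * 3).+2))) * W (k%:Z - n%:Z).
  move=> le; rewrite /W sgiS sgiP -!exprM; move: (sgi _) => s.
  have e1 : 'X^(3 * k) * 'X^(pent (k%:Z - n%:Z - 1)) =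
    'X^((n * 3).+2) * 'X^(pent (k%:Z - n%:Z)) :> {poly int}.
    by rewrite -!exprD; congr ('X^_); have := pentE (k%:Z - n%:Z - 1);
      have := pentE (k%:Z - n%:Z); lia.
  have e2 : 'X^(3 * (n.*2 + 0 - k)) * 'X^(pent (k%:Z - n%:Z + 1)) =
    'X^((n * 3).+1) * 'X^(pent (k%:Z - n%:Z)) :> {poly int}.
    by rewrite -!exprD; congr ('X^_); have := pentE (k%:Z - n%:Z + 1);
      have := pentE (k%:Z - n%:Z); lia.
  rewrite mulrCA e1 [X in _ + X = _]mulrCA e2; ring.
have ft := finite_triple_product hW K.
have tt : tideal 0 K (qpoch 'X^3 K * (\sum_(k < K.*2.+1) gbin 'X^3 K.*2 k * W
  (k%:Z - K%:Z))
              - \sum_(k < K.*2.+1) W (k%:Z - K%:Z)).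
  apply: (@theta_trunc 3 K K.*2 K (fun k => W (k%:Z - K%:Z))) => // k le;
    first by lia.
  rewrite /W mulrCA -exprD; apply/tidealMl; rewrite -['X^_]mulr1;
    apply: tidealXn.
  have := pentE (k%:Z - K%:Z); have := triE (k%:Z - K%:Z - 1).
  have := sqE (k%:Z - K%:Z + 1).
  have := sqE (k%:Z - K%:Z).
  by lia.
rewrite addn0 in ft; rewrite {}ft big_ord1 gbin0 mul1r in tt.
have W0 : W 0 = 1 by rewrite /W /sgi /pent mul0r !expr0 mul1r.
have ho : qpoch 'X^3 K * \prod_(i < K) (1 + 'X^3 ^+ (i.*2 + 0).+1 +
  - ('X^((i * 3).+1) + 'X^((i * 3).+2))) = qpoch ('X : {poly int}) (K * 3).
  elim: (K) => [|n IH]; first by rewrite /qpoch !big_ord0 mulr1.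
  rewrite mulSn !qpochS -IH big_ord_recr /= -!exprM addn0.
  have -> : (3 * n.+1)%N = (n * 3).+3 by lia.
  have -> : (3 * n.*2.+1)%N = ((n * 3).+1 + (n * 3).+2)%N by lia.
  by rewrite exprD; ring.
rewrite W0 mulr1 ho in tt.
have h2 := @qpoch_trunc1 0 K (K * 3) (leq_pmulr K (isT : 0 < 3)%N).
apply: tideal_eq (tidealD tt (tidealN h2)) _; rewrite /pentseries; ring.
Qed.

End Theta.

(** * Counting partitions by inserting and removing parts *)

Section PartitionCounting.

Definition npart (n : nat) (Q : pred (seq nat)) : nat :=
  #|[pred pi : partition_of n | Q pi]|.

Lemma geq_total : total geq.
Proof. by move=> a b; rewrite /geq /= leq_total. Qed.

Lemma sorted_geq_perm (s t : seq nat) :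
  sorted geq s -> sorted geq t -> perm_eq s t -> s = t.
Proof.
apply: sorted_eq; first by move=> a b c /= ba cb; apply: leq_trans cb ba.
by move=> a b /= ab; apply/eqP; rewrite eqn_leq andbC.
Qed.

Lemma insert_is_partition r n (s : seq nat) : 0 < r -> is_partition n s ->
  is_partition (r + n) (sort geq (r :: s)).
Proof.
move=> r0 /and3P[_ pos /eqP sum]; apply/and3P; split.
- exact: (sort_sorted geq_total).
- by rewrite all_sort /= r0.
- by rewrite (perm_sumn (s2 := r :: s)) ?perm_sort //= sum.
Qed.

Lemma remove_is_partition r n (s : seq nat) : r \in s ->
  is_partition (r + n) s -> is_partition n (rem r s).
Proof.
move=> rs /and3P[srt pos /eqP sum]; apply/and3P; split.
- apply: subseq_sorted (rem_subseq r s) srt => a b c /= ba cb.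
  exact: leq_trans cb ba.
- by apply/allP => x /mem_rem; apply/allP: x.
- by rewrite -(eqn_add2l r) -sum (perm_sumn (perm_to_rem rs)).
Qed.

Lemma npart_eq n (Q Q' : pred (seq nat)) :
  (forall s, is_partition n s -> Q s = Q' s) -> npart n Q = npart n Q'.
Proof. by move=> h; apply: eq_card => pi; rewrite !inE h //; exact: (valP pi).
  Qed.

(** Removing one copy of [r] is a bijection whose inverse inserts [r] and sorts again. *)
Lemma npart_insert r n (Q : pred (seq nat)) : 0 < r ->
  npart (r + n) (fun s => (r \in s) && Q s)
    = npart n (fun s => Q (sort geq (r :: s))).
Proof.
move=> r0.
pose ins (pi : partition_of n) := PartitionOf (insert_is_partition r0 (valP
  pi)).
have ins_inj : injective ins.
  move=> pi pi' /(congr1 val) /= eqs; apply: val_inj => /=.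
  apply: sorted_geq_perm.
  - by case/and3P: (valP pi).
  - by case/and3P: (valP pi').
  - have : perm_eq (sort geq (r :: pi)) (r :: pi') by rewrite eqs perm_sort.
    by rewrite perm_sort perm_cons.
rewrite /npart -[RHS](card_image ins_inj); apply: eq_card => pi; rewrite !inE.
apply/andP/imageP => [[rpi Qpi]|[pi' Qpi' ->]]; last first.
  by split=> //=; rewrite mem_sort mem_head.
pose pi' := PartitionOf (remove_is_partition rpi (valP pi)).
have e : sort geq (r :: rem r pi) = pi.
  apply: sorted_geq_perm; first exact: (sort_sorted geq_total).
  - by case/and3P: (valP pi).
  - by rewrite perm_sort perm_sym perm_to_rem.
exists pi'; first by rewrite inE /= e.
by apply: val_inj => /=; rewrite e.
Qed.

Lemma npart_small r n (Q : pred (seq nat)) : n < r ->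
  npart n (fun s => (r \in s) && Q s) = 0.
Proof.
move=> lt; apply: eq_card0 => pi; rewrite !inE;
  apply/negbTE/negP => /andP[rpi _].
have := mem_leq_sumn rpi; case/and3P: (valP pi) => _ _ /eqP ->.
by rewrite leqNgt lt.
Qed.

(** Either [i.+1] is not a part, or one copy of it can be removed. This is the coefficient form of
    division by 1 - q^(i+1). *)
Lemma npart_le_rec i n :
  npart n (all (geq i.+1)) = npart n (all (geq i)) +
    (if i < n then npart (n - i.+1) (all (geq i.+1)) else 0).
Proof.
rewrite /npart -(cardID [pred pi : partition_of n | i.+1 \in (pi :
  seq nat)]) addnC.
congr (_ + _).
  apply: eq_card => pi; rewrite !inE; apply/andP/idP => [[npi /allP le]|/allP
    le].
    apply/allP => x xpi; have := le x xpi;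
      rewrite /= leq_eqVlt => /orP[/eqP e|//].
    by rewrite -e xpi in npi.
  split; last by apply/allP => x /le /= h; apply: leqW.
  by apply/negP => /le /=; rewrite ltnn.
transitivity (npart n (fun s => (i.+1 \in s) && all (geq i.+1) s)).
  by apply: eq_card => pi; rewrite !inE andbC.
have [lt|le] := ltnP i n; last exact: npart_small.
rewrite -{1}(subnKC lt) npart_insert //; apply: npart_eq => s _.
by rewrite all_sort /= leqnn.
Qed.

Lemma npart_le0 n : npart n (all (geq 0)) = (n == 0).
Proof.
have h s : is_partition n s -> all (geq 0) s = (s == [::]).
  by case: s => // a s /and3P[_ /= /andP[a0 _] _]; rewrite leqNgt a0.
rewrite (npart_eq h); case: eqP => [n0|n0].
  subst n; have p0 : is_partition 0 [::] by [].
  rewrite /npart (eq_card1 (x := PartitionOf p0)) //.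
apply: eq_card0 => pi; rewrite !inE; apply/negbTE/eqP => e.
by case/and3P: (valP pi) => _ _ /=; rewrite e => /eqP /esym.
Qed.

Lemma npart_leT i n : n <= i -> npart n (all (geq i)) = npart n predT.
Proof.
move=> le; apply: npart_eq => s /and3P[_ _ /eqP sum]; apply/allP => x xs /=.
by apply: leq_trans (mem_leq_sumn xs) _; rewrite sum.
Qed.

(** Removing one copy each of m, ..., 1 takes away m(m+1)/2 and leaves an arbitrary partition. *)
Lemma npart_staircase m n :
  npart n (fun s => all (mem s) (iota 1 m))
  = if 'C(m.+1, 2) <= n then npart (n - 'C(m.+1, 2)) predT else 0.
Proof.
elim: m n => [|m IH] n; first by rewrite /= subn0.
transitivity (npart n (fun s => (m.+1 \in s) && all (mem s) (iota 1 m))).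
  apply: npart_eq => s _.
  by rewrite -[in iota _ _](addn1 m) iotaD all_cat add1n /= andbT andbC.
rewrite [in 'C(m.+2, 2)]binS bin1.
have [lt|le] := ltnP m n; last by rewrite npart_small // leqNgt (leq_trans _
  (leq_addl _ _)).
rewrite -{1}(subnKC lt) npart_insert //.
transitivity (npart (n - m.+1) (fun s => all (mem s) (iota 1 m))).
  apply: npart_eq => s _; apply: eq_in_all => x;
    rewrite mem_iota => /andP[_ lx].
  by rewrite !inE mem_sort inE ltn_eqF.
rewrite IH subnDAC subnDA; have [h|h] := leqP; have [h'|h'] := leqP => //; lia.
Qed.

Lemma mex_gt (s : seq nat) m : (m < mex s) = all (mem s) (iota 1 m).
Proof.
rewrite /mex; case: ex_minnP => x /andP[x0 xs] min; apply/idP/allP => [lt y|h].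
  rewrite mem_iota => /andP[y0 ly]; apply/negPn/negP => ys.
  by have := min y; rewrite y0 ys => /(_ isT); lia.
rewrite ltnNge; apply/negP => le; have := h x;
  rewrite mem_iota x0 /= add1n ltnS le.
by rewrite (negbTE xs) => /(_ isT).
Qed.

Lemma mex_le n (s : seq nat) : is_partition n s -> mex s <= n.+1.
Proof.
case/and3P => _ _ /eqP sum; rewrite leqNgt mex_gt; apply/negP => /allP h.
have /mem_leq_sumn : n.+1 \in s by apply: h; rewrite mem_iota /= add1n ltnS.
by rewrite sum ltnn.
Qed.

End PartitionCounting.

(** * Generating functions of partitions and of the mex sums *)

Section PartitionSeries.
Local Open Scope ring_scope.

Definition pseries (K : nat) : {poly int} := \poly_(n < K) (npart n predT)%:Z.

(** Bounding the parts by [i] gives polynomials [P i] from which the factors of f1 are stripped one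
    at a time; below degree [K] the bound [K] is no restriction. *)
Lemma pseriesP K : tideal 0 K (qpoch 'X K * pseries K - 1).
Proof.
pose P i : {poly int} := \poly_(n < K) (npart n (all (geq i)))%:Z.
have hP i : tideal 0 K ((1 - 'X^(i.+1)) * P i.+1 - P i).
  move=> n lt; rewrite dvd0z coefB mulrBl mul1r coefB coefXnM !coef_poly lt.
  have -> : (n - i.+1 < K)%N by lia.
  by rewrite npart_le_rec ltnS; case: (ltnP i n) => h; rewrite ?ltnS; lia.
have h i : tideal 0 K (qpoch 'X i * P i - 1).
  elim: i => [|i IH].
    rewrite /qpoch big_ord0 mul1r => n lt.
    by rewrite coefB coef1 coef_poly lt npart_le0; case: n lt.
  apply: tideal_eq (tidealD IH (tidealMl (qpoch 'X i) (hP i))) _.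
  by rewrite qpochS; ring.
suff <- : P K = pseries K by [].
apply/polyP => n; rewrite !coef_poly; case: ifP => // lt.
by rewrite npart_leT // ltnW.
Qed.

Definition eseries (K : nat) : {poly int} := \poly_(n < K) (sigma_e_mex n)%:Z.
Definition oseries (K : nat) : {poly int} := \poly_(n < K) (sigma_o_mex n)%:Z.

(** The partial sums of [w] select the wanted parity, so twice a mex is the sum of [w m] over
    [m < mex pi]. After exchanging sums, this condition says that 1, ..., m are parts, and the
    staircase count applies. *)
Lemma mex_weight_sum K (b : bool) n (w : nat -> int) : (n < K)%N ->
  (forall M, \sum_(m < M) w m = if odd M (+) b then (M%:Z) *+ 2 else 0) ->
  (\sum_(pi : partition_of n | odd (mex pi) (+) b) (mex pi))%:Z *+ 2
   = (pseries K * \sum_(j < K.+1) (w j)%:P * 'X^('C(j.+1, 2)))`_n.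
Proof.
move=> lt hw.
transitivity (\sum_(pi : partition_of n) \sum_(m < K.+1 | (m < mex pi)%N) w m).
  rewrite -natz natr_sum -sumrMnl big_mkcond /=; apply: eq_bigr => pi _.
  have le : (mex pi <= K.+1)%N.
    by apply: leq_trans (mex_le (valP pi)) _; rewrite ltnS ltnW.
  by rewrite natz -hw (big_ord_widen _ w le).
under eq_bigr do rewrite big_mkcond /=.
rewrite exchange_big /= mulr_sumr coef_sum; apply: eq_bigr => j _.
rewrite mulrA coefMXn mulrC coefCM coef_poly -big_mkcond /= sumr_const.
transitivity (w j * (npart n (fun s => all (mem s) (iota 1 j)))%:Z).
  rewrite -mulr_natr natz; congr (_ * (_)%:Z).
  by apply: eq_card => pi; rewrite !inE -mex_gt.
rewrite npart_staircase ltnNge (leq_ltn_trans (leq_subr _ _) lt).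
by case: ('C(_, 2) <= n)%N => //=; rewrite mulr0.
Qed.

Lemma eseriesP K : tideal 0 K (eseries K *+ 2 - pseries K * (psiseries K -
  Jseries K)).
Proof.
move=> n lt; rewrite coefB coefMn coef_poly lt dvd0z subr_eq0; apply/eqP.
rewrite /sigma_e_mex (eq_bigl (fun pi : partition_of n => odd (mex pi) (+)
  true)); last first.
  by move=> pi; rewrite dvdn2 addbT.
(* The sum of (-1)^m (2m+1) over m < M is -(-1)^M M, so [w] sums to M + (-1)^M M. *)
pose w (m : nat) : int := 1 - (-1) ^+ m * (m.*2.+1)%:Z.
rewrite (@mex_weight_sum K true n w lt).
  congr (_`_n); congr (polyseq (_ * _)); rewrite -sumrB; apply: eq_bigr => j _.
  rewrite /w rmorphB rmorphM rmorphXn rmorphN rmorph1 /= -natz rmorph_nat; ring.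
elim=> [|M IH]; first by rewrite big_ord0 mul0rn.
rewrite big_ord_recr /= IH /w -signr_odd; case: (odd M) => /=; lia.
Qed.

Lemma oseriesP K : tideal 0 K (oseries K *+ 2 - pseries K * (psiseries K +
  Jseries K)).
Proof.
move=> n lt; rewrite coefB coefMn coef_poly lt dvd0z subr_eq0; apply/eqP.
rewrite /sigma_o_mex (eq_bigl (fun pi : partition_of n => odd (mex pi) (+)
  false)); last first.
  by move=> pi; rewrite dvdn2 addbF negbK.
pose w (m : nat) : int := 1 + (-1) ^+ m * (m.*2.+1)%:Z.
rewrite (@mex_weight_sum K false n w lt).
  congr (_`_n); congr (polyseq (_ * _)); rewrite -big_split;
    apply: eq_bigr => j _ /=.
  rewrite /w rmorphD rmorphM rmorphXn rmorphN rmorph1 /= -natz rmorph_nat; ring.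
elim=> [|M IH]; first by rewrite big_ord0.
rewrite big_ord_recr /= IH /w -signr_odd; case: (odd M) => /=; lia.
Qed.

End PartitionSeries.

(** * Theta expressions of the mex series and their reductions modulo 2 and 4 *)

Section Dissection.
Local Open Scope ring_scope.

(** Multiplying 2 E = P (psi - J) by f1^2 gives 2 f1^2 E = f2^2 - f1^4. Substituting f1^2 = f2 phi
    and cancelling f2 leaves 2 phi E = f2 (1 - phi^2), and 1 - phi^2 = -4 (S + S^2). *)
Lemma eseries_theta K :
  tideal 0 K ((1 + Sseries K *+ 2) * eseries K
              + qpoch 'X^2 K * (Sseries K + Sseries K ^+ 2) *+ 2).
Proof.
have hphi := @theta_phi K; have hpsi := @theta_psi K; have hJ := @theta_J K.
have hP := @pseriesP K; have he := @eseriesP K.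
apply: (@tideal_nat _ _ 2) => //; rewrite mul0r.
apply: (@tideal_cancel _ _ (qpoch 'X^2 K)); first exact: qpoch_coef0.
move: hphi hpsi hJ hP he.
move: (qpoch 'X K) (qpoch 'X^2 K) (Sseries K) (psiseries K) (Jseries K)
  (pseries K) (eseries K).
move=> f1 f2 S psi J P e hphi hpsi hJ hP he.
have := tidealD (tidealMl (- e *+ 2 - (f1 ^+ 2 + f2 * (1 + S *+ 2))) hphi)
  (tidealD (tidealMl (f1 ^+ 2) he) (tidealD (tidealMl (f1 * (psi - J)) hP)
  (tidealD hpsi (tidealN (tidealMl f1 hJ))))).
by move/tideal_eq; apply; ring.
Qed.

Lemma oseries_theta K : tideal 0 K (oseries K - (eseries K + qpoch 'X K ^+ 2)).
Proof.
have hJ := @theta_J K; have hP := @pseriesP K; have he := @eseriesP K.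
have ho := @oseriesP K; apply: (@tideal_nat _ _ 2) => //; rewrite mul0r.
have := tidealD ho (tidealD (tidealN he) (tidealD (tidealMl (pseries K *+ 2) hJ)
  (tidealMl (qpoch 'X K ^+ 2 *+ 2) hP))).
by move/tideal_eq; apply; ring.
Qed.

(** Half of E: the identity for phi E solved for E, with the term 2 S E moved to the right. *)
Definition halfeseries K : {poly int} :=
  - (qpoch 'X^2 K * (Sseries K + Sseries K ^+ 2)) - Sseries K * eseries K.

Lemma halfeseriesP K : tideal 0 K (eseries K - halfeseries K *+ 2).
Proof. by apply: tideal_eq (@eseries_theta K) _; rewrite /halfeseries; ring.
  Qed.

Lemma tideal2Mn K (p : {poly int}) : tideal 2 K (p *+ 2).
Proof.
have h : tideal 1 K p by move=> i _; apply: dvd1z.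
by have := tidealMn 2 h; rewrite mul1r.
Qed.

Lemma halfeseries_mod2 K : tideal 2 K
  (halfeseries K + qpoch 'X^2 K * (Sseries K + Sseries K ^+ 2)).
Proof.
have h := tideal_dvd (dvdz0 2) (@halfeseriesP K).
have := tidealD (tidealMl (- Sseries K) h) (@tideal2Mn K (- (Sseries K *
  halfeseries K))).
by move/tideal_eq; apply; rewrite /halfeseries; ring.
Qed.

(** One more iteration: in S E = 2 S (E/2) the factor E/2 is needed only modulo 2. *)
Lemma halfeseries_mod4 K : tideal 4 K
  (halfeseries K + qpoch 'X^2 K * (Sseries K - Sseries K ^+ 2)
   - qpoch 'X^2 K * Sseries K ^+ 3 *+ 2).
Proof.
have h := tideal_dvd (dvdz0 4) (@halfeseriesP K).
have h2 := tidealMn 2 (tidealMl (Sseries K) (@halfeseries_mod2 K)).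
have := tidealD (tidealMl (- Sseries K) h) (tidealN h2).
by move/tideal_eq; apply; rewrite /halfeseries; ring.
Qed.

(** The Frobenius map modulo 2. *)
Lemma sqr_comp_mod2 K (p : {poly int}) : tideal 2 K (p ^+ 2 - (p \Po 'X^2)).
Proof.
elim/poly_ind: p => [|p c IH].
  by rewrite comp_poly0 expr0n subrr; apply: tideal0.
rewrite comp_polyD comp_polyM comp_polyX comp_polyC.
have hc : tideal 2 K ((c ^+ 2 - c)%:P : {poly int}).
  move=> i _; rewrite coefC; case: ifP => // _.
  have [d cd] : exists d, c = 2 * d \/ c = 2 * d + 1 by exists (c %/ 2)%Z; lia.
  by case: cd => ->; lia.
have := tidealD (tidealMl 'X^2 IH) (tidealD hc (@tideal2Mn K (p * 'X * c%:P))).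
by move/tideal_eq; apply; rewrite rmorphB rmorphXn /=; ring.
Qed.

Lemma tideal_comp2 m K (p : {poly int}) : tideal m K p ->
  tideal m K (p \Po 'X^2).
Proof.
move=> hp i hi; rewrite coef_comp_poly_Xn //; case: ifP => // _.
by apply: hp; lia.
Qed.

Lemma tideal_theta m K (p : {poly int}) : tideal m K p ->
  tideal m K ('X * p^`()).
Proof.
move=> hp [|i] hi; rewrite coefXM //= coef_deriv -mulr_natr.
by apply/dvdz_mulr/hp.
Qed.

Lemma theta_comp2 (p : {poly int}) :
  'X * (p \Po 'X^2)^`() = (('X * p^`()) \Po 'X^2) *+ 2.
Proof.
by rewrite deriv_comp derivXn comp_polyM comp_polyX /=; ring.
Qed.

Lemma qpoch_comp2 K : qpoch 'X^2 K = qpoch ('X : {poly int}) K \Po 'X^2.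
Proof.
rewrite /qpoch rmorph_prod; apply: eq_bigr => i _ /=.
by rewrite rmorphB rmorph1 rmorphXn /= comp_polyX.
Qed.

Lemma polyC_sign n : (-1) ^+ n = ((-1) ^+ n)%:P :> {poly int}.
Proof. by rewrite rmorphXn rmorphN1. Qed.

Lemma Sseries_sq K r : (0 < r)%N -> (r ^ 2 < K)%N -> (Sseries K)`_(r ^ 2) =
  (-1) ^+ r.
Proof.
case: r => // r _ lt; have rK : (r < K)%N by lia.
rewrite coef_sum (bigD1 (Ordinal rK)) //= big1 ?addr0 => [|i ne].
  by rewrite polyC_sign coefCM coefXn eqxx mulr1.
rewrite polyC_sign coefCM coefXn eqn_exp2r // eqSS.
by rewrite eq_sym -val_eqE in ne; rewrite (negbTE ne) mulr0.
Qed.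

Lemma Sseries_nsq K i : (forall r, (0 < r)%N -> i <> (r ^ 2)%N) ->
  (Sseries K)`_i = 0.
Proof.
move=> h; rewrite coef_sum big1 // => j _; rewrite polyC_sign coefCM coefXn.
by case: eqP => [/h|_]; [case | rewrite mulr0].
Qed.

Lemma sq_dec i : (exists2 r, (0 < r)%N & i = (r ^ 2)%N) \/
  (forall r, (0 < r)%N -> i <> (r ^ 2)%N).
Proof.
case: (pickP (fun r : 'I_i => i == r.+1 ^ 2)%N) => [r /eqP e|h]; first by left;
  exists r.+1.
right=> [[//|r]] _ e; have ri : (r < i)%N by lia.
by have := h (Ordinal ri); rewrite /= -e eqxx.
Qed.

(* The even squares are the numbers 4 s^2. *)
Lemma Sseries_even K i : (i < K)%N -> ~~ odd i ->
  (2 %| (Sseries K)`_i - (Sseries K \Po 'X^2 \Po 'X^2)`_i)%Z.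
Proof.
move=> lt ev; rewrite !coef_comp_poly_Xn //.
have [[r r0 ir]|h] := sq_dec i.
  have [s rs] : exists s, r = s.*2.
    by exists r./2; have := odd_double_half r; rewrite ir oddX /= in ev;
      rewrite (negbTE ev).
  have -> : i = ((s ^ 2) * 2 * 2)%N by lia.
  rewrite dvdn_mull // mulnK // dvdn_mull // mulnK // Sseries_sq; try lia.
  rewrite (_ : s ^ 2 * 2 * 2 = r ^ 2)%N ?Sseries_sq; try lia.
  by rewrite -signr_odd -[X in _ - X]signr_odd; case: (odd r); case: (odd s).
rewrite (Sseries_nsq _ h); case: ifP => // d1; case: ifP => // d2.
rewrite Sseries_nsq // => s s0 e; apply: (h s.*2); first by lia.
by have := divnK d1; have := divnK d2; lia.
Qed.

(** The operator q d/dq multiplies coefficient i by i. For odd i it therefore cancels S modulo 2;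
    for even i it vanishes, and S agrees with S(q^4). *)
Lemma Sseries_theta K :
  tideal 2 K ('X * (Sseries K)^`() + Sseries K - (Sseries K \Po 'X^2 \Po 'X^2)).
Proof.
move=> i lt; have hth : ('X * (Sseries K)^`())`_i = (Sseries K)`_i * i%:Z.
  by case: i lt => [|i] lt; rewrite coefXM ?mulr0 //= coef_deriv -mulr_natr
    natz.
rewrite coefB coefD hth; case oi: (odd i).
  have -> : (Sseries K \Po 'X^2 \Po 'X^2)`_i = 0.
    by rewrite coef_comp_poly_Xn // dvdn2 oi.
  rewrite subr0 -[X in _ + X]mulr1 -mulrDr; apply/dvdz_mull; lia.
have := Sseries_even lt (negbT oi) => h; rewrite -addrA rpredD //.
by apply/dvdz_mull; lia.
Qed.

(* Logarithmic differentiation of f1^2 = f2 phi; the difference W of both sides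
   satisfies f1 W = W(q^2) modulo 2, hence vanishes. *)
Lemma qpoch_theta K : tideal 2 K
  (qpoch 'X K * (Sseries K + (Sseries K \Po 'X^2)) - 'X * (qpoch 'X K)^`()).
Proof.
set f1 := qpoch 'X K; set S := Sseries K; set S2 := S \Po 'X^2; set W := _ - _.
pose th := 'X * f1^`(); pose th2 := th \Po 'X^2; pose f2 := f1 \Po 'X^2.
pose S4 := S2 \Po 'X^2; pose thS := 'X * S^`().
(* This is q d/dq applied to f1^2 = f2 phi, divided by 2. *)
have h1 : tideal 0 K (f1 * th - (th2 * (1 + S *+ 2) + f2 * thS)).
  apply: (@tideal_nat _ _ 2) => //; rewrite mul0r.
  have := tideal_theta (@theta_phi K); rewrite qpoch_comp2 -/f1 -/S -/f2.
  have -> : 'X * (f1 ^+ 2 - f2 * (1 + S *+ 2))^`() =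
    th * f1 *+ 2 - ('X * f2^`() * (1 + S *+ 2) + f2 * thS *+ 2).
    rewrite expr2 derivB !derivM derivD derivMn derivC /th /thS; ring.
  by rewrite theta_comp2 -/th -/th2; move/tideal_eq; apply; ring.
have hsq := @sqr_comp_mod2 K f1; rewrite -/f2 in hsq.
have hS := @Sseries_theta K; rewrite -/S -/S2 -/S4 -/thS in hS.
have hW : tideal 2 K (f1 * W - (W \Po 'X^2)).
  have -> : W \Po 'X^2 = f2 * (S2 + S4) - th2.
    by rewrite /W comp_polyB comp_polyM comp_polyD.
  have := tidealD (tidealMl (S + S2) hsq) (tidealD (tidealN (tideal_dvd (dvdz0
    2) h1))
    (tidealD (tidealMl (- f2) hS) (@tideal2Mn K (f2 * S - f2 * S4 - S * th2)))).
  by move/tideal_eq; apply; rewrite /W -/th; ring.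
have f10 : f1`_0 = 1 by have := @qpoch_coef0 1 K isT; rewrite expr1.
move=> i; elim/ltn_ind: i => i IH lt.
have := hW i lt; rewrite coefB coefM big_ord_recl /= f10 mul1r subn0.
have dcomp : (2 %| (W \Po 'X^2)`_i)%Z.
  rewrite coef_comp_poly_Xn //; case: ifP => // d.
  (* Halving the index decreases it except at 0, where the constant term of [W] is twice that of
     S. *)
  case: i IH lt d => [|i] IH lt d; last by apply: IH; lia.
  rewrite div0n /W coefB coefXM coefM big_ord1 /= coefD /S2 coef_comp_poly_Xn
    //= div0n.
  by rewrite subr0; apply/dvdz_mull; rewrite subn0; lia.
rewrite -addrA rpredDr // rpredB // rpred_sum // => j _; apply/dvdz_mull/IH.
  by rewrite /bump /= add1n; have := ltn_ord j; lia.
by rewrite /bump /= add1n; have := ltn_ord j; lia.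
Qed.

End Dissection.

(** * Divisibility of the mex sums at an index where f1^2 and f2 have coefficient 0 *)

Section Divisibility.
Local Open Scope ring_scope.

Lemma tideal_dvdB (m : int) K (p q : {poly int}) i :
  tideal m K (p - q) -> (i < K)%N -> (m %| q`_i)%Z -> (m %| p`_i)%Z.
Proof. by move=> h /h; rewrite coefB => hi hq;
  rewrite -(subrK q`_i p`_i) rpredD. Qed.

Lemma coef_comp2_odd (p : {poly int}) i : odd i -> (p \Po 'X^2)`_i = 0.
Proof. by move=> oi; rewrite coef_comp_poly_Xn // dvdn2 oi. Qed.

Lemma coef_comp2_even (p : {poly int}) i : (p \Po 'X^2)`_i.*2 = p`_i.
Proof. by rewrite coef_comp_poly_Xn // dvdn2 odd_double -muln2 mulnK. Qed.

Lemma coef_theta (p : {poly int}) i : ('X * p^`())`_i = p`_i * i%:Z.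
Proof.
by case: i => [|i]; rewrite coefXM ?mulr0 //= coef_deriv -mulr_natr natz.
Qed.

Variables (K N : nat).
Hypotheses (ltNK : (N < K)%N) (f1sqN : (qpoch ('X : {poly int}) K ^+ 2)`_N = 0).
Hypothesis f2N : (qpoch ('X^2 : {poly int}) K)`_N = 0.

Let f1 : {poly int} := qpoch 'X K.
Let f2 : {poly int} := qpoch 'X^2 K.
Let S := Sseries K.
Let S2 := S \Po 'X^2.
Let S4 := S2 \Po 'X^2.
Let hf2 : f2 = f1 \Po 'X^2. Proof. exact: qpoch_comp2. Qed.

(** Coefficient [N] of f1^2 = f2 + 2 f2 S. *)
Lemma coef_f2S : (f2 * S)`_N = 0.
Proof.
have := tideal_coef0 (@theta_phi K) ltNK.
rewrite f1sqN mulrDr mulr1 mulrnAr coefD coefMn -/f2 -/S f2N add0r -mulr_natr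
  natz; move: (_`_N); lia.
Qed.

Lemma sigma_e_half : (sigma_e_mex N)%:Z = (halfeseries K)`_N * 2.
Proof.
have := tideal_coef0 (@halfeseriesP K) ltNK.
by rewrite coef_poly ltNK coefMn => ->; rewrite mulr_natr.
Qed.

Lemma sigma_o_e : sigma_o_mex N = sigma_e_mex N.
Proof.
have := tideal_coef0 (@oseries_theta K) ltNK.
by rewrite coefD !coef_poly ltNK f1sqN addr0 => -[].
Qed.

Lemma half_mod2 : (2 %| (f2 * S2)`_N)%Z -> (2 %| (halfeseries K)`_N)%Z.
Proof.
move=> h; apply: (@tideal_dvdB _ K _ (- (f2 * S + f2 * S2))) => //.
  have := tidealD (@halfeseries_mod2 K) (tidealN (tidealMl f2 (@sqr_comp_mod2 K
    S))).
  by move/tideal_eq; apply; rewrite -/f2 -/S -/S2; ring.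
by rewrite coefN coefD coef_f2S add0r rpredN.
Qed.

Lemma f2S2_odd : odd N -> (2 %| (f2 * S2)`_N)%Z.
Proof. by move=> oN; rewrite hf2 -comp_polyM coef_comp2_odd. Qed.

(** With N = 2n this is coefficient n of f1 S. By [qpoch_theta] and the vanishing of f1 at n, it is
    congruent to that of f1 S(q^2), hence to coefficient [N] of f2 S(q^4). Modulo 2, f2 S(q^4) is q
    (f2 S)' + f2 S, because q f2' is even; both terms vanish at [N]. *)
Lemma f2S2_even : ~~ odd N -> (2 %| (f2 * S2)`_N)%Z.
Proof.
move=> eN; have [n Nn] : exists n, N = n.*2.
  by exists N./2; rewrite -[LHS]odd_double_half (negbTE eN).
have f1n : f1`_n = 0 by rewrite -coef_comp2_even -hf2 -Nn.
rewrite hf2 -comp_polyM Nn coef_comp2_even.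
have ltnK : (n < K)%N by lia.
apply: (@tideal_dvdB _ K _ ('X * f1^`() - f1 * S2) n) => //.
  by apply: tideal_eq (@qpoch_theta K) _; rewrite -/f1 -/S -/S2; ring.
rewrite coefB coef_theta f1n mul0r sub0r rpredN.
rewrite -coef_comp2_even comp_polyM -hf2 -/S4 -Nn.
apply: (@tideal_dvdB _ K _ ('X * (f2 * S)^`() + f2 * S)) => //.
  have := tidealD (tidealN (tidealMl f2 (@Sseries_theta K)))
     (@tideal2Mn K (- ('X * f1^`() \Po 'X^2) * S)).
  have hth : 'X * f2^`() = (('X * f1^`()) \Po 'X^2) *+ 2
    by rewrite hf2 theta_comp2.
  move/tideal_eq; apply; rewrite -/S -/S2 -/S4 derivM mulrDr mulrA hth; ring.
by rewrite coefD coef_theta coef_f2S mul0r addr0.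
Qed.

Lemma dvd4_sigma_e : (4 %| (sigma_e_mex N)%:Z)%Z.
Proof.
rewrite sigma_e_half (_ : 4 = 2 * 2) // dvdz_mul2r //; apply: half_mod2.
by have [/f2S2_odd|/f2S2_even] := boolP (odd N).
Qed.

(** Split S = A + B into even and odd exponents. Modulo 4 the half series is -f2 S + f2 (A^2 + B^2)
    + 2 (f2 A B + f2 S^3). The first term vanishes at [N], the second has only even exponents, and
    the bracket must be shown even. *)
Lemma half_mod4 : (N %% 4 = 1)%N -> (4 %| (halfeseries K)`_N)%Z.
Proof.
move=> N4; have oN : odd N by lia.
pose A := even_poly S \Po 'X^2; pose B := (odd_poly S \Po 'X^2) * 'X.
have SAB : S = A + B by rewrite /A /B poly_even_odd.
pose th := 'X * f1^`(); pose th2 := th \Po 'X^2.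
have hA : tideal 2 K (A - S4).
  move=> i lt; rewrite coefB; have [oi|ei] := boolP (odd i).
    by rewrite !coef_comp2_odd // subr0.
  have -> : A`_i = S`_i.
    by rewrite -[i]odd_double_half (negbTE ei) add0n coef_comp2_even
      coef_even_poly.
  exact: Sseries_even.
(* Modulo 2, S^3 is (A + B) S(q^2) and A is S(q^4), so the terms with B give B f2 (S(q^2) + S(q^4)),
   which is B [th2] by [qpoch_theta] at q^2. *)
have hZ : (2 %| (f2 * A * B + f2 * S ^+ 3)`_N)%Z.
  apply: (@tideal_dvdB _ K _ (B * th2 + f2 * A * S2)) => //.
    have hq := tideal_comp2 (@qpoch_theta K).
    have h0 : tideal 2 K (S - (A + B)) by rewrite -SAB subrr; apply: tideal0.
    have := tidealD (tidealMl (f2 * S) (@sqr_comp_mod2 K S))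
      (tidealD (tidealMl B (tidealD (tidealMl f2 hA) hq)) (tidealMl (f2 * S2)
        h0)).
    move/tideal_eq; apply; rewrite comp_polyB comp_polyM comp_polyD.
    by rewrite -/f1 -/S -/S2 -/S4 -hf2 -/th -/th2; ring.
  rewrite coefD hf2 -!comp_polyM [X in _ + X]coef_comp2_odd // addr0.
  have [n Nn] : exists n, N = n.*2.+1 by exists N./2; lia.
  have en : ~~ odd n by lia.
  rewrite /B mulrAC -comp_polyM Nn coefMX /= coef_comp2_even coefM.
  apply: rpred_sum => i _; rewrite coef_odd_poly coef_theta.
  (* For even i, n - i is even and so is its coefficient in q f1'. For odd i, 2i + 1 is 3 modulo 4,
     hence not a square. *)
  have [oi|ei] := boolP (odd i); last first.
    by rewrite !dvdz_mull //; lia.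
  rewrite Sseries_nsq ?mul0r // => r r0 e.
  have [s [rs|rs]] : exists s, r = s.*2 \/ r = s.*2.+1 by exists r./2; lia.
    by rewrite rs in e; lia.
  have : ~~ odd (s * s.+1) by rewrite oddM /= andbN.
  by rewrite rs in e; lia.
apply: (@tideal_dvdB _ K _ (- (f2 * S) + f2 * (S ^+ 2) +
  f2 * S ^+ 3 *+ 2)) => //.
  by apply: tideal_eq (@halfeseries_mod4 K) _; rewrite -/f2 -/S; ring.
have -> : - (f2 * S) + f2 * (S ^+ 2) + f2 * S ^+ 3 *+ 2 =
  - (f2 * S) + (f2 * (even_poly S ^+ 2 + odd_poly S ^+ 2 * 'X \Po 'X^2))
   + (f2 * A * B + f2 * S ^+ 3) *+ 2.
  have -> : (even_poly S ^+ 2 + odd_poly S ^+ 2 * 'X) \Po 'X^2 =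
    A ^+ 2 + B ^+ 2.
    by rewrite comp_polyD [(_ * 'X) \Po _]comp_polyM comp_polyX !rmorphXn /= /A
      /B; ring.
  have -> : S ^+ 2 = (A + B) ^+ 2 by rewrite -SAB.
  by ring.
rewrite coefD coefD coefN coef_f2S oppr0 add0r {1}hf2 -comp_polyM
  coef_comp2_odd // add0r.
by rewrite coefMn; move: hZ; move: (_`_N) => z; rewrite -[z *+ 2]mulr_natr; lia.
Qed.

Lemma dvd8_sigma_e : (N %% 4 = 1)%N -> (8 %| (sigma_e_mex N)%:Z)%Z.
Proof.
by move=> N4; rewrite sigma_e_half (_ : 8 = 4 * 2) // dvdz_mul2r // half_mod4.
Qed.

End Divisibility.

(** * Vanishing of coefficients from quadratic forms modulo p *)

Section Vanishing.
Local Open Scope ring_scope.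

Lemma dvdz_Fp p (x : int) : prime p -> (p %| x)%Z = (x%:~R == 0 :> 'F_p).
Proof. by move=> pp; apply/dvdz_pcharf/pchar_Fp. Qed.

Lemma Fp_expp p (x : 'F_p) : prime p -> x ^+ p = x.
Proof. by move=> pp; rewrite -{2}(expf_card x) card_Fp. Qed.

Lemma Fp_small p n : prime p -> (0 < n < p)%N -> n%:R != 0 :> 'F_p.
Proof.
move=> pp /andP[n0 np]; have := @dvdz_Fp p n pp; rewrite -pmulrn => <-.
by apply/negP => /(dvdn_leq n0); lia.
Qed.

(** Otherwise z = x / y satisfies z^2 = -1 in the prime field. As (p - 1)/2 is odd, z^p = -z,
    whereas Fermat gives z^p = z. *)
Lemma dvd_add_sq p (x y : int) : prime p -> (p %% 4 = 3)%N ->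
  (p %| x * x + y * y)%Z -> (p %| x)%Z && (p %| y)%Z.
Proof.
move=> pp p4; rewrite !dvdz_Fp // rmorphD !rmorphM /=.
move: (x%:~R) (y%:~R) => a b /eqP ab.
have two : 2%:R != 0 :> 'F_p by apply: Fp_small => //; lia.
have [b0|b0] := eqVneq b 0.
  by move: ab; rewrite b0 mul0r addr0 => /eqP; rewrite mulf_eq0 orbb => ->.
pose z := a / b; have z2 : z ^+ 2 = -1.
  apply: (mulIf (mulf_neq0 b0 b0)); rewrite mulN1r /z.
  have -> : (a / b) ^+ 2 * (b * b) = a * a by field.
  by apply/eqP; rewrite -addr_eq0 ab.
have := Fp_expp z pp; have ep : p = (2 * (p %/ 4).*2.+1 + 1)%N by lia.
rewrite [X in z ^+ X]ep.
rewrite exprD exprM z2 -signr_odd /= odd_double expr1 => zz.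
have : z * 2%:R = 0 by rewrite -[X in X * _]zz; rewrite mulr_natr mulr2n {2}zz;
  ring.
move/eqP; rewrite mulf_eq0 (negbTE two) orbF => /eqP z0.
by move/eqP: z2; rewrite z0 expr0n eq_sym oppr_eq0 oner_eq0.
Qed.

Lemma dvd_add_3sq p (x y : int) : prime p -> (p %% 3 = 2)%N -> odd p ->
  (p %| x * x + 3 * (y * y))%Z -> (p %| x)%Z && (p %| y)%Z.
Proof.
move=> pp p3 op; rewrite !dvdz_Fp // rmorphD !rmorphM /=.
move: (x%:~R) (y%:~R) => a b /eqP ab.
have p5 : (3 < p)%N by have := prime_gt1 pp; lia.
have two : 2%:R != 0 :> 'F_p by apply: Fp_small => //; lia.
have three : 3%:R != 0 :> 'F_p by apply: Fp_small => //; lia.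
have four : 4%:R != 0 :> 'F_p by apply: Fp_small => //; lia.
have [b0|b0] := eqVneq b 0.
  by move: ab; rewrite b0 !mulr0 addr0 => /eqP; rewrite mulf_eq0 orbb => ->.
(* A square root of -3 yields a primitive cube root of unity. *)
pose w := (a / b - 1) / 2%:R.
have w3 : w ^+ 2 + w + 1 = 0.
  have -> : w ^+ 2 + w + 1 = (a * a + 3%:R * (b * b)) / (4%:R * (b * b)).
    by rewrite /w; field; rewrite b0 two four.
  by rewrite ab mul0r.
have w1 : w ^+ 3 = 1.
  apply/eqP; rewrite -subr_eq0; apply/eqP.
  have -> : w ^+ 3 - 1 = (w - 1) * (w ^+ 2 + w + 1) by ring.
  by rewrite w3 mulr0.
(* Fermat gives w = w^p = w^2, hence w = 1, and w^2 + w + 1 = 0 becomes 3 = 0. *)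
have := Fp_expp w pp; have ep : p = (3 * (p %/ 3) + 2)%N by lia.
rewrite [X in w ^+ X]ep.
rewrite exprD exprM w1 expr1n mul1r => ww.
have wn : w = 1 by rewrite -w1 exprS ww -expr2 ww.
by move: three; rewrite -w3 wn (_ : 1 ^+ 2 + 1 + 1 = 3%:R) ?eqxx //; ring.
Qed.

Lemma coef_mul_sum0 (I J : finType) (c : I -> int) (d : J -> int)
    (e : I -> nat) (f : J -> nat) N :
  (forall i j, e i + f j != N)%N ->
  ((\sum_i (c i)%:P * 'X^(e i)) * (\sum_j (d j)%:P * 'X^(f j)))`_N = 0.
Proof.
move=> h; rewrite mulr_suml coef_sum big1 // => i _.
rewrite mulr_sumr coef_sum big1 // => j _.
rewrite mulrACA -polyCM -exprD coefCM coefXn eq_sym (negbTE (h i j)) mulr0 //.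
Qed.

Lemma sgi_polyC j : sgi j = ((-1) ^+ `|j|%N)%:P.
Proof. exact: polyC_sign. Qed.

Lemma pentseries_comp2 K : pentseries K \Po 'X^2 =
  \sum_(k < K.*2.+1) ((-1) ^+ `|k%:Z - K%:Z|%N)%:P * 'X^(2 * pent (k%:Z -
    K%:Z)).
Proof.
rewrite /pentseries rmorph_sum /=; apply: eq_bigr => k _.
by rewrite comp_polyM sgi_polyC comp_polyC [_ \Po _]rmorphXn /= comp_polyX
  -exprM.
Qed.

Variables (p N K : nat).
Hypotheses (pp : prime p)
  (p12 : (p %% 12 = 5 \/ p %% 12 = 7 \/ p %% 12 = 11)%N)
  (pdvd : (p %| 12 * N + 1)%N) (pndvd : ~~ (p ^ 2 %| 12 * N + 1)%N)
  (ltNK : (N < K)%N).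

Lemma p_odd : odd p. Proof. by lia. Qed.

Lemma pdvdz : (p %| 12 * N%:Z + 1)%Z.
Proof. by have -> : 12 * N%:Z + 1 = (12 * N + 1)%N%:Z by lia. Qed.

Lemma no_dvd (x y c : int) : (p %| x)%Z -> (p %| y)%Z ->
  12 * N%:Z + 1 <> x * x + c * (y * y).
Proof.
move=> px py e; move/negP: pndvd; apply.
suff : (p%:Z ^+ 2 %| 12 * N%:Z + 1)%Z.
  by rewrite (_ : 12 * N%:Z + 1 = (12 * N + 1)%N%:Z);
    [rewrite dvdzE abszX | lia].
rewrite e expr2; apply: rpredD; first exact: dvdz_mul.
exact/dvdz_mull/dvdz_mul.
Qed.

(** An exponent N = j(3j-1) of f2 makes 12 N + 1 the square of 6j - 1, which [p] cannot divide
    exactly once. *)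
Lemma f2_vanish : (qpoch ('X^2 : {poly int}) K)`_N = 0.
Proof.
rewrite qpoch_comp2 (@tideal_coef0 K _ (pentseries K \Po 'X^2)) //; last first.
  by rewrite -comp_polyB; apply/tideal_comp2/pentagonal.
rewrite pentseries_comp2 coef_sum big1 // => k _; rewrite coefCM coefXn.
case: eqP => [eN|]; last by rewrite mulr0.
have := pentE (k%:Z - K%:Z); move: (k%:Z - K%:Z) eN => j eN ej.
have e : 12 * N%:Z + 1 = (6 * j - 1) * (6 * j - 1) by lia.
have pj : (p %| 6 * j - 1)%Z.
  by have := pdvdz; rewrite e !dvdzE abszM /= Euclid_dvdM // orbb.
by case: (@no_dvd (6 * j - 1) 0 0 pj (dvdz0 _)); lia.
Qed.

Lemma f1sq_vanish : (qpoch ('X : {poly int}) K ^+ 2)`_N = 0.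
Proof.
(* This covers the residues 7 and 11 modulo 12; the remaining residue 5 is 2 modulo 3. *)
have [p4|p4] := eqVneq (p %% 4)%N 3.
  rewrite (@tideal_coef0 K _ (pentseries K ^+ 2)) //; last first.
    have := tidealMl (qpoch 'X K + pentseries K) (@pentagonal K).
    by move/tideal_eq; apply; ring.
  rewrite expr2 /pentseries; under eq_bigr do rewrite sgi_polyC.
  apply: coef_mul_sum0 => i j; apply/eqP => eN.
  have := pentE (i%:Z - K%:Z); have := pentE (j%:Z - K%:Z).
  move: eN; move: (i%:Z - K%:Z) (j%:Z - K%:Z) => {}i {}j eN ej ei.
  have e : (12 * N%:Z + 1) * 2 = (6 * i - 1) * (6 * i - 1) +
    (6 * j - 1) * (6 * j - 1) by lia.
  have /andP[pi pj] : (p %| 6 * i - 1)%Z && (p %| 6 * j - 1)%Z.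
    by apply: dvd_add_sq => //; rewrite -e; apply/dvdz_mulr/pdvdz.
  move/negP: pndvd; apply.
  rewrite -(Gauss_dvdl _ (p := 2)); last by rewrite coprimeXl // coprimen2
    p_odd.
  suff : (p%:Z ^+ 2 %| (12 * N%:Z + 1) * 2)%Z.
    by rewrite (_ : (12 * N%:Z + 1) * 2 = ((12 * N + 1) * 2)%N%:Z);
      [rewrite dvdzE abszX | lia].
  by rewrite e expr2; apply: rpredD; apply: dvdz_mul.
rewrite (tideal_coef0 (@theta_phi K) ltNK) mulrDr mulr1 mulrnAr coefD f2_vanish
  add0r coefMn.
rewrite (@tideal_coef0 K _ ((pentseries K \Po 'X^2) * Sseries K)) //;
  last first.
  rewrite qpoch_comp2 -mulrBl -comp_polyB.
  by apply/tidealMr/tideal_comp2/pentagonal.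
rewrite pentseries_comp2 /Sseries; under [X in _ * X]eq_bigr do rewrite
  polyC_sign.
rewrite coef_mul_sum0 ?mul0rn // => i j; apply/eqP => eN.
have := pentE (i%:Z - K%:Z); move: (i%:Z - K%:Z) eN => {}i eN ei.
(* The term 12 y^2 is written 3 (2y)^2 to fit [dvd_add_3sq]. *)
have e : 12 * N%:Z + 1 = (6 * i - 1) * (6 * i - 1) +
  3 * ((2 * j.+1%:Z) * (2 * j.+1%:Z)) by lia.
have /andP[pi pj] : (p %| 6 * i - 1)%Z && (p %| 2 * j.+1%:Z)%Z.
  by apply: dvd_add_3sq => //; [lia | exact: p_odd | rewrite -e; exact: pdvdz].
exact: no_dvd pi pj e.
Qed.

End Vanishing.

(** * The arithmetic progressions and the three congruences *)

Lemma arith_progression_exact p a n k N : prime p ->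
  (p %% 12 = 5 \/ p %% 12 = 7 \/ p %% 12 = 11) -> 1 <= k < p ->
  N = a * p ^ 2 * n + k * p + (p ^ 2 - 1) %/ 12 ->
  (p %| 12 * N + 1) && ~~ (p ^ 2 %| 12 * N + 1).
Proof.
move=> pp p12 /andP[k0 kp] ->.
have p2 : 12 * ((p ^ 2 - 1) %/ 12) + 1 = p ^ 2.
  have [q pq] : exists q, p = 12 * q + p %% 12 by exists (p %/ 12); lia.
  by case: p12 => [h|[h|h]]; rewrite h in pq; rewrite pq; nia.
set d := (p ^ 2 - 1) %/ 12 in p2 *.
(* Modulo p^2 only 12 k p survives, and [p] divides neither 12 nor [k]. *)
have -> : 12 * (a * p ^ 2 * n + k * p + d) + 1 =
  (12 * a * n + 1) * p ^ 2 + 12 * k * p by nia.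
apply/andP; split; first by rewrite dvdn_add ?dvdn_mull // (dvdn_exp 2).
rewrite dvdn_addr; last exact: dvdn_mull.
rewrite -mulnn dvdn_pmul2r ?prime_gt0 //.
rewrite Euclid_dvdM // negb_or; apply/andP; split; apply/negP.
  move=> d12; have le := dvdn_leq (isT : 0 < 12) d12.
  have : p = 5 \/ p = 7 \/ p = 11 by lia.
  by case=> [e|[e|e]]; rewrite e in d12.
by move/(dvdn_leq k0); rewrite leqNgt kp.
Qed.

(** The choice of [k] modulo 4 places the index in the class required by [dvd8_sigma_e]. *)
Lemma progression_mod4 p k n :
  (p %% 24 = 11 /\ k %% 4 = 1) \/ ((p %% 24 = 5 \/ p %% 24 = 7) /\ k %% 4 =
    3) ->
  (4 * p ^ 2 * n + k * p + (p ^ 2 - 1) %/ 12) %% 4 = 1.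
Proof.
move=> h; have kp4 : k * p = (k %% 4) * (p %% 4) %[mod 4] by rewrite modnMm.
have p4 : p %% 4 = p %% 24 %% 4 by rewrite modn_dvdm.
(* Replacing p by its residue r modulo 24 changes (p^2 - 1)/12 by a multiple of 4, so c = (r^2 -
   1)/12 decides. *)
have [r [c [pr d4 rk]]] : exists r c, [/\ p %% 24 = r, r ^ 2 - 1 = 12 * c
    & (k %% 4 * (r %% 4) + c) %% 4 = 1].
  by case: h => [[pr ->]|[[pr|pr] ->]]; [exists 11, 10 | exists 5, 2 | exists
    7, 4].
have r0 : 0 < r by move: d4 pr h; clear; case: r; lia.
have -> : (p ^ 2 - 1) %/ 12 = 4 * (12 * (p %/ 24) ^ 2 + p %/ 24 * r) + c.
  suff -> : p ^ 2 - 1 = 12 * (4 * (12 * (p %/ 24) ^ 2 + p %/ 24 * r) + c)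
    by rewrite mulKn.
  rewrite {1}(divn_eq p 24) pr; move: (p %/ 24) d4 r0 => q; clear; nia.
rewrite p4 pr in kp4; rewrite -mulnA; move: kp4 rk.
move: (p ^ 2 * n) (k * p) (_ * _ ^ 2 + _) (_ * (r %% 4)); clear; lia.
Qed.

Lemma mod_dvdz d m : (Posz d %| Posz m)%Z -> m = 0 %[mod d].
Proof. by rewrite dvdzE /= => /eqP ->; rewrite mod0n. Qed.

Theorem theorem1p2 (n : nat) :
  [/\ (forall p k : nat,
         prime p ->
         p = 5 %[mod 12] \/ p = 7 %[mod 12] \/ p = 11 %[mod 12] ->
         odd k -> 1 <= k < p ->
         sigma_e_mex (2 * p ^ 2 * n + k * p + (p ^ 2 - 1) %/ 12)
           = 0 %[mod 4]),
      (forall p k : nat,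
         prime p ->
         p = 5 %[mod 24] \/ p = 7 %[mod 24] \/ p = 11 %[mod 24] ->
         1 <= k < p ->
         (p = 11 %[mod 24] -> k = 1 %[mod 4]) ->
         (p = 5 %[mod 24] \/ p = 7 %[mod 24] -> k = 3 %[mod 4]) ->
         sigma_e_mex (4 * p ^ 2 * n + k * p + (p ^ 2 - 1) %/ 12)
           = 0 %[mod 8]) &
      (forall p k : nat,
         prime p ->
         p = 5 %[mod 24] \/ p = 7 %[mod 24] \/ p = 11 %[mod 24] ->
         1 <= k < p ->
         (p = 5 %[mod 24] \/ p = 11 %[mod 24] -> k = 0 %[mod 4]) ->
         (p = 7 %[mod 24] -> k = 2 %[mod 4]) ->
         sigma_o_mex (4 * p ^ 2 * n + k * p + (p ^ 2 - 1) %/ 12)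
           = 0 %[mod 4])].
Proof.
have p12 p : p = 5 %[mod 24] \/ p = 7 %[mod 24] \/ p = 11 %[mod 24] ->
  p %% 12 = 5 \/ p %% 12 = 7 \/ p %% 12 = 11 by lia.
split.
- move=> p k pp h ok kp.
  have hp : p %% 12 = 5 \/ p %% 12 = 7 \/ p %% 12 = 11 by lia.
  have /andP[d1 d2] := @arith_progression_exact p 2 n k _ pp hp kp erefl.
  (* The truncation order is taken just above the index, K = N + 1. *)
  apply: mod_dvdz; apply: (dvd4_sigma_e (ltnSn _)).
    exact: f1sq_vanish pp hp d1 d2 (ltnSn _).
  exact: f2_vanish pp hp d1 d2 (ltnSn _).
- move=> p k pp h kp h1 h2; have hp := p12 p h.
  have /andP[d1 d2] := @arith_progression_exact p 4 n k _ pp hp kp erefl.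
  apply: mod_dvdz; apply: (dvd8_sigma_e (ltnSn _)).
  + exact: f1sq_vanish pp hp d1 d2 (ltnSn _).
  + exact: f2_vanish pp hp d1 d2 (ltnSn _).
  + by apply: progression_mod4; move: h h1 h2; clear; lia.
- move=> p k pp h kp h1 h2; have hp := p12 p h.
  have /andP[d1 d2] := @arith_progression_exact p 4 n k _ pp hp kp erefl.
  have v1 := f1sq_vanish pp hp d1 d2 (ltnSn _).
  (* The odd and even sums differ by a coefficient of f1^2, which is 0 here. *)
  rewrite (sigma_o_e (ltnSn _) v1).
  apply: mod_dvdz; apply: (dvd4_sigma_e (ltnSn _)) => //.
  exact: f2_vanish pp hp d1 d2 (ltnSn _).
Qed.
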